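(* Let $p\in(1,\infty)$, $\gamma\in(-1,\infty)$, $m\in[0,\gamma+1)$, $\beta=\frac{\gamma+2}{\gamma+1-m}$, and let $\mathfrak a:\mathbb R^n\to\mathbb R$ be continuous with $0<\lambda_0\le\mathfrak a\le\Lambda_0<\infty$. Let $u$ be a non-negative viscosity solution of $$|\nabla u(x)|^{\gamma}\Delta_p^{\mathrm N}u(x)=\mathfrak a(x)u_+^m(x)\quad\text{in }\mathbb R^n$$ with $u(x_0)=0$ for some $x_0\in\mathbb R^n$. If $$u(x)=o\big(|x|^{\beta}\big)\quad\text{as }|x|\to\infty,$$ then $u\equiv0$.
   Context: $B_r(x)$ is the open ball in $\mathbb R^n$ of radius $r$ centred at $x$; $u_+=\max\{u,0\}$, $u_+^m=(u_+)^m$. The normalized $p$-Laplacian is $\Delta_p^{\mathrm N}u=\Delta u+(p-2)\left\langle D^2u\,\frac{\nabla u}{|\nabla u|},\frac{\nabla u}{|\nabla u|}\right\rangle$. Viscosity solutions of $|\nabla u|^\gamma\Delta_p^{\mathrm N}u=f(x,u)$ in an open set $\Omega$ ($f$ continuous), for continuous $u$: Case $\gamma\ge0$. $u$ is a subsolution (resp. supersolution) if whenever $\phi\in C^2(\Omega)$ and $u-\phi$ has a local maximum (resp. minimum) at $x_0\in\Omega$ with $\phi(x_0)=u(x_0)$: (1) if $\nabla\phi(x_0)\ne0$, then $|\nabla\phi(x_0)|^\gamma\Delta_p^{\mathrm N}\phi(x_0)\ge f(x_0,\phi(x_0))$ (resp. $\le$); (2) if $\nabla\phi(x_0)=0$,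 then for $p\ge2$: $\Delta\phi(x_0)+(p-2)\lambda_{\max}(D^2\phi(x_0))\ge f(x_0,\phi(x_0))$ (resp. $\Delta\phi(x_0)+(p-2)\lambda_{\min}(D^2\phi(x_0))\le f(x_0,\phi(x_0))$), and for $1<p<2$ the same with $\lambda_{\max}$ and $\lambda_{\min}$ interchanged. Here $\lambda_{\max},\lambda_{\min}$ denote the largest and smallest eigenvalues. Case $-1<\gamma<0$. $u$ is a subsolution (resp. supersolution) if for all $\varphi\in C^2(\Omega)$ such that $u-\varphi$ has a local maximum (resp. minimum) at $x_0$, $\varphi(x_0)=u(x_0)$, and $\nabla\varphi(x)\ne0$ for $x\ne x_0$, one has $\lim_{r\to0}\inf_{x\in B_r(x_0),x\ne x_0}\left(-|\nabla\varphi(x)|^\gamma\Delta_p^{\mathrm N}\varphi(x)\right)\le -f(x_0,\varphi(x_0))$ (resp. $\lim_{r\to0}\sup_{x\in B_r(x_0),x\ne x_0}\left(-|\nabla\varphi(x)|^\gamma\Delta_p^{\mathrm N}\varphi(x)\right)\ge -f(x_0,\varphi(x_0))$). A solution is both a subsolution and a supersolution. *)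

(* Defs.v *)
From mathcomp Require Import all_boot all_order all_algebra.
From mathcomp Require Import all_classical all_reals all_analysis.

Set Implicit Arguments.
Unset Strict Implicit.
Unset Printing Implicit Defensive.

Import Order.TTheory GRing.Theory Num.Theory.
Import numFieldNormedType.Exports.

Local Open Scope classical_set_scope.
Local Open Scope ring_scope.

(* Points of R^N, N >= 1, are row vectors 'rV[R]_n.+1 with N = n.+1.  The
   library norm `|x| on row vectors is the sup norm; it induces the usual
   topology, but every metric notion below uses the Euclidean norm [enorm]. *)
Section Euclidean.
Variables (R : realType) (n : nat).
Local Notation V := 'rV[R]_n.+1.

Definition inner (x y : V) : R := \sum_i x 0 i * y 0 i.

Definition enorm (x : V) : R := Num.sqrt (inner x x).

Definition eball (x : V) (r : R) : set V := [set y | enorm (y - x) < r].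

(* The filter "|x| -> oo". *)
Definition enorm_infty : set_system V :=
  filter_from setT (fun M : R => [set x | M < enorm x]).

Global Instance enorm_infty_filter : Filter enorm_infty.
Proof.
apply: filter_from_filter; first by exists 0.
move=> M N _ _; exists (Num.max M N) => // x /=.
by rewrite gt_max => /andP[].
Qed.

Canonical enorm_infty_filter_on := FilterType enorm_infty enorm_infty_filter.

End Euclidean.

Arguments enorm_infty {R n}.

Section Calculus.
Variables (R : realType) (n : nat).
Local Notation V := 'rV[R]_n.+1.
Implicit Types (O : set V) (phi : V -> R) (x : V).

Definition partial (i : 'I_n.+1) phi : V -> R := 'D_(delta_mx 0 i) phi.

Definition C1_on O phi : Prop := forall i x, O x ->
  derivable phi x (delta_mx 0 i) /\ {for x, continuous (partial i phi)}.

Definition C2_on O phi : Prop :=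
  C1_on O phi /\ forall i, C1_on O (partial i phi).

Definition grad phi x : V := \row_i partial i phi x.

Definition hess phi x : 'M[R]_n.+1 :=
  \matrix_(i, j) partial j (partial i phi) x.

Definition laplacian phi x : R := \tr (hess phi x).

(* Only meaningful where [grad phi x != 0]. *)
Definition normalized_plaplacian (p : R) phi x : R :=
  let xi := (enorm (grad phi x))^-1 *: grad phi x in
  laplacian phi x + (p - 2) * inner (xi *m hess phi x) xi.

(* Applied to Hessians of C^2 functions, which are symmetric of positive size:
   the spectrum is then finite and nonempty, and [sup], [inf] are attained. *)
Definition lambda_max (X : 'M[R]_n.+1) : R := sup [set l | eigenvalue X l].
Definition lambda_min (X : 'M[R]_n.+1) : R := inf [set l | eigenvalue X l].

Definition local_max (g : V -> R) x : Prop := \forall y \near x, g y <= g x.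
Definition local_min (g : V -> R) x : Prop := \forall y \near x, g x <= g y.

End Calculus.

Section Viscosity.
Variables (R : realType) (n : nat).
Local Notation V := 'rV[R]_n.+1.
Variables (p gamma : R) (O : set V) (f : V -> R -> R) (u : V -> R).

Definition equation_op (phi : V -> R) (x : V) : R :=
  enorm (grad phi x) `^ gamma * normalized_plaplacian p phi x.

Definition subsolution_nonneg : Prop := forall (phi : V -> R) (x0 : V),
  C2_on O phi -> O x0 -> local_max (u \- phi) x0 -> phi x0 = u x0 ->
  (grad phi x0 != 0 -> f x0 (phi x0) <= equation_op phi x0) /\
  (grad phi x0 = 0 ->
     f x0 (phi x0) <= laplacian phi x0 + (p - 2) *
       (if 2 <= p then lambda_max (hess phi x0) else lambda_min (hess phi x0))).

Definition supersolution_nonneg : Prop := forall (phi : V -> R) (x0 : V),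
  C2_on O phi -> O x0 -> local_min (u \- phi) x0 -> phi x0 = u x0 ->
  (grad phi x0 != 0 -> equation_op phi x0 <= f x0 (phi x0)) /\
  (grad phi x0 = 0 ->
     laplacian phi x0 + (p - 2) *
       (if 2 <= p then lambda_min (hess phi x0) else lambda_max (hess phi x0))
     <= f x0 (phi x0)).

(* The inner infima and suprema are taken in the extended reals: [equation_op]
   may be unbounded near a critical point when [gamma < 0].  They are monotone
   in [r], so the limits exist in the extended reals. *)
Definition subsolution_neg : Prop := forall (phi : V -> R) (x0 : V),
  C2_on O phi -> O x0 -> local_max (u \- phi) x0 -> phi x0 = u x0 ->
  (forall x, O x -> x != x0 -> grad phi x != 0) ->
  (lim (ereal_inf [set (- equation_op phi x)%:E | x in eball x0 r `\ x0]
          @[r --> 0^'+])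
   <= (- f x0 (phi x0))%:E)%E.

Definition supersolution_neg : Prop := forall (phi : V -> R) (x0 : V),
  C2_on O phi -> O x0 -> local_min (u \- phi) x0 -> phi x0 = u x0 ->
  (forall x, O x -> x != x0 -> grad phi x != 0) ->
  ((- f x0 (phi x0))%:E <=
   lim (ereal_sup [set (- equation_op phi x)%:E | x in eball x0 r `\ x0]
          @[r --> 0^'+]))%E.

Definition viscosity_subsolution : Prop :=
  if 0 <= gamma then subsolution_nonneg else subsolution_neg.

Definition viscosity_supersolution : Prop :=
  if 0 <= gamma then supersolution_nonneg else supersolution_neg.

(* |grad u|^gamma * Delta_p^N u = f(x, u) in the open set O. *)
Definition viscosity_solution : Prop :=
  [/\ {within O, continuous u}, viscosity_subsolution
    & viscosity_supersolution].

End Viscosity.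

(* [a x * u_+^m].  For m = 0 the power is the constant 1 (powR has
   0 `^ 0 = 1), which is the reading that keeps f continuous. *)
Definition absorption (R : realType) (n : nat) (a : 'rV[R]_n.+1 -> R) (m : R)
  (x : 'rV[R]_n.+1) (s : R) : R := a x * (Num.max s 0) `^ m.

(* Main.v *)
(* The function c |x - y|^beta has exactly the growth at which both sides of the
   equation scale alike, and for small c it is a strict supersolution away from
   y.  If u x > u y + c |x - y|^beta for some x and y, then u - c |. - y|^beta,
   which tends to -oo because u = o(|x|^beta), attains its maximum at some
   z != y, where u is touched from above by a translate of the barrier: this
   contradicts the subsolution property.  Hence u x <= u y + c |x - y|^beta for
   all x, y and all small c; letting c -> 0, u is constant, equal to u x0 = 0.

   The barrier is singular or critical at y, which the definition forbids for
   gamma < 0.  With r = |z - y|, D = (z - y)/r^2 and w = x - z it is therefore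
   replaced by the larger function
     c r^beta exp (beta (D.w + |D|^2 |w|^2 - (D.w)^2)),
   which agrees with it at z, is smooth and has no critical point. *)
Require Import Defs.
From mathcomp Require Import all_boot all_order all_algebra.
From mathcomp Require Import all_classical all_reals all_analysis.
From mathcomp Require Import ring lra.
Import Order.TTheory GRing.Theory Num.Theory.
Import numFieldNormedType.Exports.
Local Open Scope classical_set_scope.
Local Open Scope ring_scope.

Set Implicit Arguments.
Unset Strict Implicit.
Unset Printing Implicit Defensive.

(** * Euclidean inner product and norm *)

Section Inner.
Variables (R : realType) (n : nat).
Local Notation V := 'rV[R]_n.+1.
Implicit Types (x y z v : V) (k : R).

Lemma innerC x y : inner x y = inner y x.
Proof. by apply: eq_bigr => i _; rewrite mulrC. Qed.

Lemma innerDl x y z : inner (x + y) z = inner x z + inner y z.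
Proof. by rewrite -big_split; apply: eq_bigr => i _; rewrite mxE mulrDl. Qed.

Lemma innerZl k x y : inner (k *: x) y = k * inner x y.
Proof. by rewrite mulr_sumr; apply: eq_bigr => i _; rewrite mxE mulrA. Qed.

Lemma innerDr x y z : inner x (y + z) = inner x y + inner x z.
Proof. by rewrite innerC innerDl !(innerC x). Qed.

Lemma innerZr k x y : inner x (k *: y) = k * inner x y.
Proof. by rewrite innerC innerZl innerC. Qed.

Lemma innerNl x y : inner (- x) y = - inner x y.
Proof. by rewrite -scaleN1r innerZl mulN1r. Qed.

Lemma innerNr x y : inner x (- y) = - inner x y.
Proof. by rewrite innerC innerNl innerC. Qed.

Definition innerE := (innerDl, innerDr, innerZl, innerZr, innerNl, innerNr).

Lemma inner_delta x i : inner x (delta_mx 0 i) = x 0 i.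
Proof.
rewrite /inner (bigD1 i)//= big1 ?addr0 => [|j ji]; rewrite mxE eqxx ?eqxx.
  by rewrite mulr1.
by rewrite (negPf ji) mulr0.
Qed.

Lemma inner_ge0 x : 0 <= inner x x.
Proof. by apply: sumr_ge0 => i _; rewrite -expr2 sqr_ge0. Qed.

Lemma inner_eq0 x : (inner x x == 0) = (x == 0).
Proof.
apply/idP/eqP => [|->]; last by rewrite -(scale0r 0) innerZl mul0r.
rewrite psumr_eq0 => [/allP x0|i _]; last by rewrite -expr2 sqr_ge0.
apply/rowP => i; rewrite mxE; apply/eqP.
by have := x0 i (mem_index_enum i); rewrite mulf_eq0 orbb.
Qed.

Lemma inner_gt0 x : (0 < inner x x) = (x != 0).
Proof. by rewrite lt_def inner_ge0 andbT inner_eq0. Qed.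

Lemma inner_cauchy_schwarz x y : inner x y ^+ 2 <= inner x x * inner y y.
Proof.
have [->|y0] := eqVneq y 0.
  by rewrite -(scale0r 0) !innerE !mul0r expr0n mulr0.
have y2 : 0 < inner y y by rewrite inner_gt0.
(* After multiplication by |y|^2 the gap is the squared norm of |y|^2 x - (x.y) y. *)
rewrite -(ler_pM2l y2) -subr_ge0.
have := inner_ge0 (inner y y *: x - inner x y *: y).
rewrite !innerE (innerC y x); nra.
Qed.

Lemma normr_inner_le x y e : 0 <= e ->
  inner x x * inner y y <= e ^+ 2 -> `|inner x y| <= e.
Proof.
move=> e0 xye; rewrite -sqrtr_sqr -(ger0_norm e0) -[leRHS]sqrtr_sqr.
by apply: ler_wsqrtr; exact: le_trans (inner_cauchy_schwarz x y) xye.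
Qed.

Lemma enorm_ge0 x : 0 <= enorm x. Proof. exact: sqrtr_ge0. Qed.

Lemma sqr_enorm x : enorm x ^+ 2 = inner x x.
Proof. by rewrite sqr_sqrtr// inner_ge0. Qed.

Lemma enorm_gt0 x : (0 < enorm x) = (x != 0).
Proof. by rewrite sqrtr_gt0 inner_gt0. Qed.

Lemma enormZ k x : 0 <= k -> enorm (k *: x) = k * enorm x.
Proof.
by move=> k0; rewrite /enorm !innerE mulrA -expr2 sqrtrM ?sqr_ge0// sqrtr_sqr
  ger0_norm.
Qed.

(** Links sup-norm balls, used for compactness, to the growth condition, which is stated in the
    Euclidean norm. *)
Lemma normr_le_enorm x : `|x| <= enorm x.
Proof.
rewrite /Num.norm/= mx_normrE; apply/bigmax_leP; split=> [|[i j] _/=].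
  exact: enorm_ge0.
rewrite (ord1 i) -sqrtr_sqr ler_sqrt ?inner_ge0// /inner (bigD1 j)//= -expr2.
by rewrite lerDl; apply: sumr_ge0 => k _; rewrite -expr2 sqr_ge0.
Qed.

Lemma enorm0 : enorm (0 : V) = 0.
Proof. by apply/eqP; rewrite sqrtr_eq0 -(scale0r 0) innerZl mul0r. Qed.

Lemma enorm_le x y k : 0 <= k ->
  inner x x <= k ^+ 2 * inner y y -> enorm x <= k * enorm y.
Proof.
move=> k0 xy; apply: le_trans (ler_wsqrtr xy) _.
by rewrite sqrtrM ?sqr_ge0// sqrtr_sqr ger0_norm.
Qed.

Lemma powR_enorm x r : enorm x `^ r = inner x x `^ (r / 2).
Proof. by rewrite /enorm -powR12_sqrt ?inner_ge0// -powRrM mulrC. Qed.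

Lemma continuous_inner (T : topologicalType) (f g : T -> V) :
  continuous f -> continuous g -> continuous (fun t => inner (f t) (g t)).
Proof.
move=> cf cg; rewrite /inner.
have ccoord i (h : T -> V) : continuous h -> continuous (fun t => h t 0 i).
  move=> ch t; apply: (@continuous_comp _ _ _ h (fun v : V => v 0 i)).
    exact: ch.
  exact: coord_continuous.
apply: continuous_big => [|i _ t]; first exact: add_continuous.
by apply: cvgM; exact: ccoord.
Qed.

End Inner.

(** * Real powers and derivatives along lines *)

Section RealAnalysis.
Variables (R : realType).

Lemma continuous_powR (T : topologicalType) (g : T -> R) (r : R) : 0 < r ->
  (forall t, 0 <= g t) -> continuous g -> continuous (fun t => g t `^ r).
Proof.
move=> r0 g0 cg t.
have := g0 t; rewrite le_eqVlt => /predU1P[gt0|gt0]; last first.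
  apply: (continuous_comp (f := g) (g := fun s => s `^ r)); first exact: cg.
  apply: differentiable_continuous; apply/derivable1_diffP.
  by apply: derivable_powR; rewrite in_itv/= gt0.
apply/cvgrPdist_lt => e e0; rewrite -gt0 powR0 ?gt_eqF//.
(* At a zero of [g] differentiability of the power may fail, so the modulus is explicit: [g s] below
   e^(1/r) forces its power below e. *)
have e1 : 0 < e `^ r^-1 by rewrite powR_gt0.
have := cg t; move/cvgrPdist_lt => /(_ _ e1); apply: filterS => s /=.
rewrite -gt0 !sub0r !normrN !ger0_norm ?powR_ge0// => gs.
have := gt0_ltr_powR r0 (g0 s) (powR_ge0 _ _) gs.
by rewrite -powRrM mulVf ?gt_eqF// powRr1// ltW.
Qed.

Lemma continuous_subr (n : nat) (z : 'rV[R]_n.+1) :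
  continuous (fun x : 'rV[R]_n.+1 => x - z).
Proof.
by move=> x; apply: continuousB; [exact: cvg_id|exact: cst_continuous].
Qed.

Lemma nbhs_eball (n : nat) (z : 'rV[R]_n.+1) r :
  0 < r -> \forall x \near z, eball z r x.
Proof.
move=> r0.
have cI := continuous_inner (@continuous_subr _ z) (@continuous_subr _ z).
have r2 : inner (z - z) (z - z) < r ^+ 2.
  by rewrite -sqr_enorm subrr enorm0 expr0n exprn_gt0.
have /cvgr_lt/(_ _ r2) := cI z; apply: filterS => x xr.
by rewrite /eball /= -(gtr0_norm r0) -sqrtr_sqr ltr_sqrt// exprn_gt0.
Qed.

(** Reduces a directional derivative to a one-variable one, which instance resolution computes once
    [f] is explicit along the line. *)
Lemma is_derive_line (V W : normedModType R) (f : V -> W) (x v : V) (a : W) :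
  is_derive (0 : R) (1 : R) (fun h : R => f (h *: v + x)) a ->
  is_derive x v f a.
Proof.
move=> [df dfa]; apply: DeriveDef; first exact/derivable1P.
rewrite -dfa /derive.
set g1 := fun h => h^-1 *: _; set g2 := fun h => h^-1 *: _.
suff -> : g1 = g2 by [].
by rewrite funeqE /g1 /g2 => h /=; rewrite addr0 scale0r add0r [_%:A]mulr1.
Qed.

(** For r >= 0 the upper bound on x does the work, for r < 0 the lower one; the exponent |r| on L
    serves both signs. *)
Lemma powR_le_of_ratio (x b L r : R) : 0 < b -> 1 <= L ->
  b / L <= x <= b * L -> x `^ r <= b `^ r * L `^ `|r|.
Proof.
move=> b0 L1 /andP[xl xr].
have L0 : 0 < L by lra.
have x0 : 0 < x by rewrite (lt_le_trans _ xl)// divr_gt0.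
have ge0 y : 0 < y -> y \is Num.nneg by move=> ?; exact: ltW.
have [r0|r0] := lerP 0 r.
  rewrite ger0_norm// -powRM; [|exact: ltW..].
  by apply: ge0_ler_powR => //; apply: ge0 => //; rewrite mulr_gt0.
have bL0 : 0 < b / L by rewrite divr_gt0.
have : (b / L) `^ (- r) <= x `^ (- r).
  by apply: ge0_ler_powR => //; [lra|exact: ge0|exact: ge0].
have LV : L^-1 `^ (- r) = (L `^ (- r))^-1.
  by rewrite -(powR_inv1 (ltW L0)) -powRrM mulN1r -powRN.
rewrite ltr0_norm// powRM; [|exact: ltW|by rewrite invr_ge0 ltW].
rewrite LV ler_pdivrMr ?powR_gt0// (powRN b) (powRN x).
by rewrite ler_pdivlMl ?powR_gt0// ler_pdivrMr ?powR_gt0// mulrC.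
Qed.

End RealAnalysis.

(** * The exponential barrier: derivatives and bounds on the operator *)

Section TestFunction.
Variables (R : realType) (n : nat).
Local Notation V := 'rV[R]_n.+1.
Variables (k A b : R) (D z : V).
Implicit Types x v : V.

(** The quadratic part sees only the component of x - z orthogonal to D, so along D the exponent is
    affine with slope b |D|^2. *)
Definition exponent x : R :=
  b * (inner D (x - z) + inner D D * inner (x - z) (x - z)
       - inner D (x - z) ^+ 2).

(** The gradient of [exponent]. *)
Definition slope x : V :=
  b *: (D + (2 * inner D D) *: (x - z) - (2 * inner D (x - z)) *: D).

Definition test_fun x : R := k + A * expR (exponent x).

(** The Hessian of [exponent] as a bilinear form, the same at every point. *)
Definition exponent_hess v v' : R :=
  b * (2 * inner D D * inner v v' - 2 * inner D v * inner D v').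

(** The second-order Taylor formula, exact for a quadratic polynomial; the derivatives of the test
    function are read off from it. *)
Lemma exponent_line x v (h : R) : exponent (h *: v + x) =
  exponent x + h * inner (slope x) v + h ^+ 2 * (2^-1 * exponent_hess v v).
Proof.
rewrite /exponent /slope /exponent_hess -addrA !innerE.
rewrite (innerC x v) (innerC z v); by field.
Qed.

Lemma slope_line x v (h : R) i :
  slope (h *: v + x) 0 i = slope x 0 i + h * exponent_hess v (delta_mx 0 i).
Proof.
rewrite /slope /exponent_hess !inner_delta -!(addrA (h *: v)) !innerE !mxE.
by ring.
Qed.

Lemma is_derive_test_fun x v :
  is_derive x v test_fun (A * expR (exponent x) * inner (slope x) v).
Proof.
apply: is_derive_line; rewrite /test_fun.
under eq_fun do rewrite exponent_line.
apply: is_derive_eq.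
rewrite /GRing.scale /= !(scale0r, mul0r, expr0n, addr0, mulr0, add0r, mulr1).
by rewrite !mul1r mulrA.
Qed.

Lemma is_derive_partial_test_fun x v i :
  is_derive x v (fun y => A * expR (exponent y) * slope y 0 i)
   (A * expR (exponent x) * (inner (slope x) v * slope x 0 i
     + exponent_hess v (delta_mx 0 i))).
Proof.
apply: is_derive_line.
under eq_fun do rewrite exponent_line slope_line.
apply: is_derive_eq.
rewrite /GRing.scale /= !(scale0r, mul0r, expr0n, addr0, mulr0, add0r, mulr1).
by ring.
Qed.

Lemma partial_test_fun i :
  partial i test_fun = fun x => A * expR (exponent x) * slope x 0 i.
Proof.
apply/funext => x; rewrite /partial.
by have /@derive_val -> := is_derive_test_fun x (delta_mx 0 i);
  rewrite inner_delta.
Qed.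

Lemma partial2_test_fun i j x : partial j (partial i test_fun) x =
  A * expR (exponent x) * (slope x 0 j * slope x 0 i
     + exponent_hess (delta_mx 0 j) (delta_mx 0 i)).
Proof.
rewrite partial_test_fun /partial.
by have /@derive_val -> := is_derive_partial_test_fun x (delta_mx 0 j) i;
  rewrite inner_delta.
Qed.

Let continuous_add (f g : V -> R) :
  continuous f -> continuous g -> continuous (fun x => f x + g x).
Proof. by move=> cf cg x; apply: continuousD; [exact: cf|exact: cg]. Qed.

Let continuous_sub (f g : V -> R) :
  continuous f -> continuous g -> continuous (fun x => f x - g x).
Proof. by move=> cf cg x; apply: continuousB; [exact: cf|exact: cg]. Qed.

Let continuous_mul (f g : V -> R) :
  continuous f -> continuous g -> continuous (fun x => f x * g x).
Proof. by move=> cf cg x; apply: continuousM; [exact: cf|exact: cg]. Qed.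

Let continuous_const (c : R) : continuous (fun _ : V => c).
Proof. exact: cst_continuous. Qed.

Let continuous_innerD : continuous (fun x => inner D (x - z)).
Proof.
exact: (continuous_inner (@cst_continuous _ _ D) (@continuous_subr _ _ z)).
Qed.

Lemma continuous_exponent : continuous exponent.
Proof.
rewrite /exponent; apply: continuous_mul => //; apply: continuous_sub.
  apply: continuous_add => //; apply: continuous_mul => //.
  exact: (continuous_inner (@continuous_subr _ _ z) (@continuous_subr _ _ z)).
exact: (continuous_mul continuous_innerD continuous_innerD).
Qed.

Lemma continuous_coord_slope i : continuous (fun x => slope x 0 i).
Proof.
have -> : (fun x => slope x 0 i) = fun x =>
    b * (D 0 i + 2 * inner D D * (x 0 i - z 0 i)
         - 2 * inner D (x - z) * D 0 i).
  by apply/funext => x; rewrite !mxE.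
apply: continuous_mul => //; apply: continuous_sub.
  apply: continuous_add => //; apply: continuous_mul => //.
  by apply: continuous_sub => //; exact: coord_continuous.
by apply: continuous_mul => //; apply: continuous_mul.
Qed.

Lemma C2_test_fun O : C2_on O test_fun.
Proof.
have cE : continuous (fun x => A * expR (exponent x)).
  apply: continuous_mul => // x.
  apply: continuous_comp; first exact: continuous_exponent.
  exact: continuous_expR.
split=> [i x _|i j x _]; split.
- by have [] := is_derive_test_fun x (delta_mx 0 i).
- rewrite partial_test_fun.
  exact: (continuous_mul cE (@continuous_coord_slope i)).
- by rewrite partial_test_fun;
    have [] := is_derive_partial_test_fun x (delta_mx 0 j) i.
- rewrite (_ : partial j _ = fun x => A * expR (exponent x) *
    (slope x 0 j * slope x 0 i
     + exponent_hess (delta_mx 0 j) (delta_mx 0 i))); last first.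
    by apply/funext => y; exact: partial2_test_fun.
  apply: continuous_mul => //; apply: continuous_add => //.
  exact: (continuous_mul (@continuous_coord_slope _) (@continuous_coord_slope _)).
Qed.

Lemma grad_test_fun x :
  grad test_fun x = (A * expR (exponent x)) *: slope x.
Proof. by apply/rowP => i; rewrite mxE [RHS]mxE partial_test_fun. Qed.

Lemma hess_test_fun x : hess test_fun x = (A * expR (exponent x)) *:
  ((slope x)^T *m slope x
   + b *: ((2 * inner D D)%:M - 2 *: (D^T *m D))).
Proof.
apply/matrixP => i j; rewrite mxE partial2_test_fun [RHS]mxE; congr (_ * _).
rewrite [RHS]mxE [(_ *m _) i j]mxE big_ord1 [_^T i 0]mxE [slope x 0 j * _]mulrC.
congr (_ + _).
rewrite /exponent_hess !inner_delta !mxE big_ord1 !mxE eqxx andTb.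
by rewrite mulr_natr; ring.
Qed.

Lemma mulmx_tr_inner (v w : V) : v *m w^T = (inner v w)%:M.
Proof.
apply/matrixP => i j; rewrite !ord1 !mxE mulr1n /inner.
by apply: eq_bigr => l _; rewrite mxE.
Qed.

(** The space has dimension n + 1; the rank-one term in D removes one dimension from the trace,
    which leaves the factor n. *)
Lemma laplacian_test_fun x : laplacian test_fun x = A * expR (exponent x) *
  (inner (slope x) (slope x) + 2 * b * n%:R * inner D D).
Proof.
rewrite /laplacian hess_test_fun !(mxtraceZ, mxtraceD, linearN, mxtrace_scalar)/=.
rewrite mxtraceZ !(mxtrace_mulC _^T) !mulmx_tr_inner !mxtrace_scalar !mulr1n.
by rewrite -[_ *+ n.+1]mulr_natr -(natr1 n); ring.
Qed.

Lemma hess_form_test_fun x v : inner (v *m hess test_fun x) v =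
  A * expR (exponent x) * (inner (slope x) v ^+ 2 + exponent_hess v v).
Proof.
rewrite hess_test_fun; move: (slope x) => s.
rewrite -scalemxAr mulmxDr mulmxA -scalemxAr mulmxBr -scalemxAr mulmxA.
rewrite !mulmx_tr_inner !mul_scalar_mx mul_mx_scalar !innerE.
by rewrite /exponent_hess (innerC v D) (innerC v s); ring.
Qed.

Lemma inner_slope x : inner D (slope x) = b * inner D D.
Proof. by rewrite /slope !innerE; ring. Qed.

Lemma sqr_slope x : inner (slope x) (slope x) = b ^+ 2 * inner D D *
  (1 + 4 * (inner D D * inner (x - z) (x - z) - inner D (x - z) ^+ 2)).
Proof.
by rewrite /slope; move: (x - z) => w; rewrite !innerE (innerC w D); ring.
Qed.

Hypotheses (A0 : 0 < A) (b0 : 0 < b) (D0 : D != 0).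

(** By [inner_slope] its product with D is the positive constant b |D|^2. *)
Lemma slope_neq0 x : slope x != 0.
Proof.
apply/eqP => s0; have := inner_slope x; rewrite s0 -(scale0r 0) innerZr mul0r.
by apply/eqP; rewrite eq_sym mulf_neq0 ?gt_eqF// inner_gt0.
Qed.

Lemma grad_test_fun_neq0 x : grad test_fun x != 0.
Proof.
rewrite grad_test_fun scaler_eq0 negb_or slope_neq0 andbT.
by rewrite gt_eqF// mulr_gt0// expR_gt0.
Qed.

(** The normalized gradient [xi] is a unit vector, so Cauchy-Schwarz controls the second derivative
    along it; |p - 2| makes the bound independent of the sign of p - 2. *)
Lemma plaplacian_test_fun_le p x : normalized_plaplacian p test_fun x <=
  A * expR (exponent x) * (1 + `|p - 2|) *
  (inner (slope x) (slope x) + 2 * b * n.+1%:R * inner D D).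
Proof.
rewrite /normalized_plaplacian; set xi := (_ *: grad _ _).
have xi1 : inner xi xi = 1.
  rewrite /xi !innerE -sqr_enorm expr2 mulKf ?mulVf// gt_eqF//;
  by rewrite enorm_gt0 grad_test_fun_neq0.
rewrite laplacian_test_fun hess_form_test_fun /exponent_hess xi1.
have sCS := inner_cauchy_schwarz (slope x) xi.
have DCS := inner_cauchy_schwarz D xi.
rewrite xi1 !mulr1 in sCS DCS.
have cA : 0 < A * expR (exponent x) by rewrite mulr_gt0// expR_gt0.
move: (A * _) cA => c c0.
have s2 := inner_ge0 (slope x).
have bD0 : 0 <= b * inner D D by rewrite mulr_ge0 ?inner_ge0 ?ltW.
have bt : b * inner D xi ^+ 2 <= b * inner D D by rewrite ler_pM2l.
have bt0 : 0 <= b * inner D xi ^+ 2 by rewrite mulr_ge0 ?sqr_ge0 ?ltW.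
have bn : 0 <= b * inner D D * n%:R by rewrite mulr_ge0.
(* Up to the factor [c], [X] is the second derivative in the direction [xi]. It is non-negative
   because (D.xi)^2 <= |D|^2. *)
set X := _ ^+ 2 + b * _.
set Y := inner (slope x) (slope x) + 2 * (b * inner D D).
have X0 : 0 <= X by rewrite /X; have := sqr_ge0 (inner (slope x) xi); lra.
have XY : X <= Y by rewrite /X /Y; lra.
have PX : (p - 2) * X <= `|p - 2| * Y.
  apply: (@le_trans _ _ (`|p - 2| * X)); first by rewrite ler_wpM2r// ler_norm.
  by rewrite ler_wpM2l.
have PZ : 0 <= `|p - 2| * (b * inner D D * n%:R) by rewrite mulr_ge0.
rewrite -subr_ge0 -(natr1 n); move: PX; rewrite /Y; move: X X0 XY => X _ _ PX.
set lhs := (X in 0 <= X).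
have -> : lhs = c * (2 * (b * inner D D)
    + (`|p - 2| * (inner (slope x) (slope x) + 2 * (b * inner D D))
       - (p - 2) * X)
    + 2 * (`|p - 2| * (b * inner D D * n%:R))) by rewrite /lhs; ring.
apply: mulr_ge0; [exact: ltW|lra].
Qed.

(* Near z the norm of the gradient is within a factor 2e of A b |D|, which
   controls its power gamma whatever the sign of gamma. *)
Lemma equation_op_test_fun_le p gamma eps x :
  eps <= 2^-1 -> 2 * b * eps <= 1 ->
  inner D D * inner (x - z) (x - z) <= eps ^+ 2 -> 0 < eps ->
  equation_op p gamma test_fun x <=
  (A * b * enorm D) `^ gamma * (2 * expR 1) `^ `|gamma| *
  (A * expR 1 * (1 + `|p - 2|) * (4 * b ^+ 2 + 2 * b * n.+1%:R)
     * enorm D ^+ 2).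
Proof.
move=> eps2 beps near_z eps0.
have D2 : 0 < inner D D by rewrite inner_gt0.
have Dd : 0 < enorm D by rewrite enorm_gt0.
have al : - eps <= inner D (x - z) <= eps.
  by rewrite -ler_norml normr_inner_le// ltW.
have CS := inner_cauchy_schwarz D (x - z).
have sg0 : 0 <= inner D D * inner (x - z) (x - z) - inner D (x - z) ^+ 2 by lra.
have sg : inner D D * inner (x - z) (x - z) - inner D (x - z) ^+ 2
    <= eps * 2^-1.
  rewrite (@le_trans _ _ (eps ^+ 2))//; last by rewrite expr2 ler_pM2l.
  by have := sqr_ge0 (inner D (x - z)); lra.
(* The bracket multiplied by b is at most 2 eps in absolute value, and 2 b eps <= 1; this is the
   origin of the factors [expR 1]. *)
have qle : -1 <= exponent x <= 1.
  have : - (2 * eps) <= inner D (x - z) + inner D D * inner (x - z) (x - z)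
     - inner D (x - z) ^+ 2 <= 2 * eps by lra.
  by case/andP; rewrite -(ler_pM2l b0) -(ler_pM2l b0 _ (2 * eps)) /exponent; lra.
have s2 := sqr_slope x.
have bD : 0 < b ^+ 2 * inner D D by rewrite mulr_gt0 ?exprn_gt0.
(* By [sqr_slope] the squared norm is b^2 |D|^2 times 1 + 4 (|D|^2 |w|^2 - (D.w)^2) with w = x - z,
   a factor between 1 and 1 + 2 eps <= 2. *)
have sl : b * enorm D <= enorm (slope x) <= 2 * (b * enorm D).
  rewrite -enormZ ?(ltW b0)//; apply/andP; split.
    rewrite -[leRHS]mul1r; apply: enorm_le => //.
    rewrite expr1n mul1r s2 innerZl innerZr mulrA -expr2 ler_peMr ?(ltW bD)//; lra.
  apply: enorm_le => //.
  rewrite s2 innerZl innerZr (mulrA b) -expr2 [leRHS]mulrC ler_pM2l//; lra.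
have s4 : inner (slope x) (slope x) <= 4 * b ^+ 2 * enorm D ^+ 2.
  rewrite s2 sqr_enorm -[leRHS]mulrA [leRHS]mulrC ler_pM2l//; lra.
have eq1 : expR (- 1) <= expR (exponent x) <= expR 1 by rewrite !ler_expR.
have ce : 0 < A * expR (exponent x) by rewrite mulr_gt0// expR_gt0.
rewrite /equation_op; apply: (@le_trans _ _ (enorm (grad test_fun x) `^ gamma *
  (A * expR 1 * (1 + `|p - 2|) * (4 * b ^+ 2 + 2 * b * n.+1%:R)
     * enorm D ^+ 2))).
  rewrite ler_wpM2l ?powR_ge0// (le_trans (plaplacian_test_fun_le _ _))//.
  rewrite -[leRHS]mulrA; apply: ler_pM.
  - by rewrite mulr_ge0 ?ltW// ltr_wpDr.
  - by rewrite addr_ge0 ?inner_ge0// !mulr_ge0 ?inner_ge0 ?(ltW b0).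
  - by rewrite ler_wpM2r ?addr_ge0// ler_pM2l//; case/andP: eq1.
  - by rewrite [leRHS]mulrDl -(sqr_enorm D) lerD2r.
rewrite ler_wpM2r//.
  have b20 : 0 <= 4 * b ^+ 2 + 2 * b * n.+1%:R.
    by rewrite addr_ge0// !mulr_ge0 ?sqr_ge0 ?(ltW b0).
  by rewrite !mulr_ge0 ?enorm_ge0// ?addr_ge0// ?expR_ge0 ?(ltW A0).
apply: powR_le_of_ratio.
- by rewrite !mulr_gt0.
- have := @expR_ge1Dx R 1; lra.
rewrite grad_test_fun enormZ ?(ltW ce)//.
have e1 : 0 < expR 1 :> R := expR_gt0 _.
case/andP: sl => sl1 sl2; case/andP: eq1 => eq1 eq2.
have Ab0 : 0 <= A * (b * enorm D) by rewrite !mulr_ge0 ?enorm_ge0 ?ltW.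
have -> : A * b * enorm D * (2 * expR 1) = (A * expR 1) * (2 * (b * enorm D)).
  by ring.
apply/andP; split; last first.
  by apply: ler_pM => //; rewrite ?(ltW ce) ?enorm_ge0 ?ler_pM2l.
rewrite (@le_trans _ _ (A * expR (- 1) * (b * enorm D)))//.
  rewrite expRN invfM -(mulrA A b) -(mulrA A _^-1) (mulrC _^-1 (b * _)).
  rewrite (mulrC 2^-1) !mulrA -(mulrA A b).
  have : 0 <= A * (b * enorm D) / expR 1 by rewrite divr_ge0// ltW.
  by lra.
by apply: ler_pM => //; rewrite ?mulr_ge0 ?expR_ge0 ?enorm_ge0 ?ler_pM2l// ltW.
Qed.

End TestFunction.

(** * Comparing the barrier with the power, and testing the subsolution *)

Section Touching.
Variables (R : realType) (n : nat).
Local Notation V := 'rV[R]_n.+1.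

(* With a = D.w, S = |D|^2 |w|^2 and t = a + S - a^2, one has
   |x - y|^2 = |z - y|^2 (1 + 2a + S) and 1 + 2a + S <= (1 + t)^2 <= exp (2t). *)
Lemma powR_enorm_le_test_fun (b : R) (y z x : V) :
  let D := (inner (z - y) (z - y))^-1 *: (z - y) in
  0 < b -> z != y -> inner D D * inner (x - z) (x - z) <= 2^-1 ^+ 2 ->
  enorm (x - y) `^ b <= enorm (z - y) `^ b * expR (exponent b D z x).
Proof.
move=> D b0; rewrite -subr_eq0 => zy near_z.
have : `|inner D (x - z)| <= 2^-1 by apply: normr_inner_le; [lra|].
rewrite ler_norml => /andP[al _].
have E : inner (x - y) (x - y) =
    inner (z - y) (z - y)
    * (1 + 2 * inner D (x - z) + inner D D * inner (x - z) (x - z)).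
  have d2 : inner (z - y) (z - y) != 0 by rewrite inner_eq0.
  rewrite -(subrKA z x) /D; move: (z - y) (x - z) d2 => d w d2.
  by rewrite !innerE (innerC w d); field.
have CS := inner_cauchy_schwarz D (x - z).
rewrite /exponent.
set t := (X in b * X).
have -> : expR (b * t) = expR (2 * t) `^ (b / 2).
  by rewrite -expRM; congr expR; field.
rewrite !powR_enorm -powRM ?expR_ge0 ?inner_ge0//.
apply: ge0_ler_powR; first by rewrite divr_ge0// ltW.
- by rewrite nnegrE inner_ge0.
- by rewrite nnegrE mulr_ge0 ?expR_ge0 ?inner_ge0.
rewrite E ler_wpM2l ?inner_ge0// expRM_natl.
have t1 : 0 <= 1 + t by rewrite /t; lra.
apply: (@le_trans _ _ ((1 + t) ^+ 2)); last first.
  by rewrite lerXn2r ?nnegrE ?expR_ge0 ?expR_ge1Dx.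
rewrite /t -subr_ge0; move: al CS.
move: (inner D (x - z)) (inner D D * inner (x - z) (x - z)) => a S al CS.
(* Both factors are non-negative: S >= a^2 by Cauchy-Schwarz, and a >= -1/2 near z. *)
have -> : (1 + (a + S - a ^+ 2)) ^+ 2 - (1 + 2 * a + S) =
  (S - a ^+ 2) * (S - a ^+ 2 + (1 + 2 * a)) by ring.
by apply: mulr_ge0; lra.
Qed.

(** Treats both definitions at once: for gamma >= 0 the operator is evaluated at z, for gamma < 0 a
    bound on a whole ball passes to the limit of the infima. *)
Lemma subsolution_bound (p gamma : R) (f : V -> R -> R) (u phi : V -> R) (z : V)
    (C d : R) :
  viscosity_subsolution p gamma setT f u -> C2_on setT phi ->
  local_max (u \- phi) z -> phi z = u z -> (forall x, grad phi x != 0) ->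
  0 < d -> (forall x, eball z d x -> equation_op p gamma phi x <= C) ->
  f z (u z) <= C.
Proof.
rewrite /viscosity_subsolution => + C2 umax phiz grad0 d0 opC.
have zz : eball z d z.
  by rewrite /eball /= subrr enorm0.
case: ifPn => [_ sub|_ sub].
  have [/(_ (grad0 z)) + _] := sub phi z C2 I umax phiz.
  by rewrite phiz => /le_trans; apply; exact: opC.
have := sub phi z C2 I umax phiz (fun x _ _ => grad0 x).
rewrite phiz => limf.
suff : ((- C)%:E <= (- f z (u z))%:E)%E by rewrite lee_fin lerN2.
apply: le_trans limf; apply: lime_ge.
  (* A larger ball gives a smaller infimum, so the limit exists in the extended reals and [lim]
     denotes it. *)
  apply: nonincreasing_at_right_is_cvge; near=> e => r s _ _ rs.
  apply: ereal_inf_le_tmp => _ [x [xr xz] <-]; exists x => //; split => //.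
  exact: lt_le_trans rs.
near=> r; apply/ereal_infP => _ [x [xr _] <-].
rewrite lee_fin lerN2; apply: opC; apply: lt_le_trans xr _.
near: r; exact: nbhs_right_le.
Unshelve. all: by end_near. Qed.

End Touching.

(** * Homogeneity of the equation *)

Section Scaling.
Variables (R : realType).

(** The relation on b is exactly what balances the powers of r, so that beyond (c r^b)^m only a
    power of c remains. *)
Lemma scaling_identity (b gamma m c r : R) : 0 < b -> 0 < c -> 0 < r ->
  b * (gamma + 1 - m) = gamma + 2 ->
  (c * r `^ b * b * r^-1) `^ gamma * (c * r `^ b * r^-1 ^+ 2) =
  b `^ gamma * c `^ (gamma + 1 - m) * (c * r `^ b) `^ m.
Proof.
move=> b0 c0 r0 bE.
have -> : c * r `^ b * b * r^-1 = b * (c * r `^ b * r^-1) by ring.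
rewrite powRM ?(ltW b0) ?mulr_ge0 ?powR_ge0 ?invr_ge0 ?ltW// -!mulrA.
congr (_ * _).
(* With c and r written as exponentials, the exponents agree by [bE] multiplied by [ln r]. *)
have [E E'] : c = expR (ln c) /\ r = expR (ln r) by rewrite !lnK.
rewrite {}E {}E'; move: (ln c) (ln r) => s t.
rewrite -expRN -!expRM -expRM_natl -!expRD -!expRM -!expRD; congr expR.
have : t * (b * (gamma + 1 - m)) = t * (gamma + 2) by rewrite bE.
by lra.
Qed.

End Scaling.

(** * Existence of a maximum and the growth estimate *)

Section Growth.
Variables (R : realType) (n : nat).
Local Notation V := 'rV[R]_n.+1.

(** Outside a large ball the difference is at most 0, hence at most its value [u y] at y; inside,
    compactness gives the maximum. *)
Lemma coercive_max (b c : R) (u : V -> R) (y : V) : 0 < b -> 0 < c ->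
  continuous u -> u =o_ enorm_infty (fun x => enorm x `^ b) -> 0 <= u y ->
  exists z, forall x,
    u x - c * enorm (x - y) `^ b <= u z - c * enorm (z - y) `^ b.
Proof.
move=> b0 c0 cu /eqoP uo uy.
(* The factor 2^b absorbs |x| <= 2 |x - y|, valid for large x. *)
have c2 : 0 < c / 2 `^ b by rewrite divr_gt0 ?powR_gt0.
have [M _ uM] := uo _ c2.
(* [M] comes from the little-o, 2 |y| yields |x| <= 2 |x - y| beyond K, and the sup norm of y puts y
   in the ball. *)
pose K := Num.max M (Num.max (2 * enorm y) `|y|).
pose S := [set x : V | `|x| <= K].
have Sy : S y by rewrite /S /= /K !le_max lexx !orbT.
have cv : continuous (fun x => u x - c * enorm (x - y) `^ b).
  pose g (x : V) : R := inner (x - y) (x - y) `^ (b / 2).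
  have cg : continuous g.
    apply: continuous_powR; first by rewrite divr_gt0.
      by move=> t; exact: inner_ge0.
    exact: (continuous_inner (@continuous_subr _ _ y) (@continuous_subr _ _ y)).
  under eq_fun do rewrite powR_enorm.
  move=> x; apply: (continuousB (f := u) (g := fun x => c * g x)).
    exact: cu.
  by apply: (continuousM (s := cst c)); [exact: cst_continuous|exact: cg].
have cS : compact S.
  apply: bounded_closed_compact.
    exists K; split; first exact: num_real.
    by move=> L KL x /= /le_trans; apply; exact: ltW.
  apply: (@closed_comp _ _ (fun x : V => `|x|) [set t | t <= K]).
    by move=> x _; exact: norm_continuous.
  exact: closed_le.
have [z zS zmax] := EVT_max_rV (ex_intro _ y Sy) cS (continuous_subspaceT cv).
exists z => x.
have [xK|Kx] := lerP `|x| K; first by apply: zmax; rewrite inE.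
apply: (@le_trans _ _ (u y - c * enorm (y - y) `^ b)); last first.
  by apply: zmax; rewrite inE.
have y0 : enorm (y - y) `^ b = 0 by rewrite subrr enorm0 powR0 ?gt_eqF.
rewrite y0 mulr0 subr0 (le_trans _ uy)// subr_le0.
have Kex : K < enorm x by exact: lt_le_trans (normr_le_enorm x).
have := Kex; rewrite /K !gt_max => /and3P[Mx yx _].
have /(le_trans (ler_norm _))/le_trans := uM x Mx; apply.
rewrite (ger0_norm (powR_ge0 _ _)).
rewrite mulrAC -mulrA ler_pM2l// ler_pdivrMr ?powR_gt0//.
rewrite -powRM ?enorm_ge0// [_ * 2]mulrC.
apply: ge0_ler_powR; rewrite ?nnegrE ?mulr_ge0 ?enorm_ge0 ?(ltW b0)//.
apply: enorm_le => //.
have y4 : 4 * inner y y <= inner x x.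
  rewrite -!sqr_enorm; have := enorm_ge0 y; have := enorm_ge0 x; nra.
(* Twice |x - 2y|^2 >= 0, added to [y4], gives |x|^2 <= 4 |x - y|^2. *)
have := inner_ge0 (x - y - y); rewrite !(innerDl, innerDr, innerNl, innerNr).
rewrite (innerC y x); lra.
Qed.

Variables (p gamma m b lambda0 : R) (a u : V -> R).

(** What remains of the bound in [equation_op_test_fun_le] for A = c r^b and |D| = 1/r after
    removing c^(gamma + 1 - m) A^m. *)
Definition barrier_const : R := b `^ gamma * (2 * expR 1) `^ `|gamma| *
  (expR 1 * (1 + `|p - 2|) * (4 * b ^+ 2 + 2 * b * n.+1%:R)).

Hypotheses (b0 : 0 < b) (hb : b * (gamma + 1 - m) = gamma + 2) (m0 : 0 <= m).
Hypotheses (cu : continuous u) (u0 : forall x, 0 <= u x).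
Hypotheses (lambda0_gt0 : 0 < lambda0) (al : forall x, lambda0 <= a x).
Hypothesis u_sub : viscosity_subsolution p gamma setT (absorption a m) u.
Hypothesis uo : u =o_ enorm_infty (fun x => enorm x `^ b).

Lemma barrier_const_gt0 : 0 < barrier_const.
Proof.
have b2 : 0 < 4 * b ^+ 2 + 2 * b * n.+1%:R.
  by rewrite addr_gt0// ?mulr_gt0 ?exprn_gt0 ?ltr0n.
by rewrite !mulr_gt0 ?powR_gt0 ?mulr_gt0 ?expR_gt0// ltr_wpDr.
Qed.

(** At a maximum point z other than y one has u z > A = c r^b, so the right-hand side of the
    equation is at least lambda0 A^m, while the operator on the barrier stays strictly below
    that. *)
Lemma subsolution_le_barrier c : 0 < c ->
  barrier_const * c `^ (gamma + 1 - m) < lambda0 ->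
  forall x y, u x <= u y + c * enorm (x - y) `^ b.
Proof.
move=> c0 cl x y; rewrite leNgt; apply/negP; rewrite -ltrBrDr => xy.
have [z zmax] := coercive_max b0 c0 cu uo (u0 y).
have uz := lt_le_trans xy (zmax x).
have zy : z != y.
  apply/eqP => zE; move: uz.
  by rewrite zE subrr enorm0 powR0 ?gt_eqF// mulr0 subr0 ltxx.
have d0 : 0 < enorm (z - y) by rewrite enorm_gt0 subr_eq0.
set d := z - y in uz d0; pose r := enorm d; pose A := c * r `^ b.
pose D := (inner d d)^-1 *: d.
have A0 : 0 < A by rewrite mulr_gt0 ?powR_gt0.
have eD : enorm D = r^-1.
  rewrite enormZ ?invr_ge0 ?inner_ge0// -sqr_enorm -/r expr2 invfM mulfVK//.
  by rewrite gt_eqF.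
have D0 : D != 0 by rewrite -enorm_gt0 eD invr_gt0.
(* The exponent vanishes at z, so the constant u z - A gives contact there. *)
pose phi := test_fun (u z - A) A b D z.
(* The two thresholds of [equation_op_test_fun_le]; since |D| = 1/r, the matching ball around z has
   radius e r. *)
pose e : R := Num.min 2^-1 (2 * b)^-1.
have e0 : 0 < e by rewrite lt_min !invr_gt0 mulr_gt0 ?ltr0n.
have e2 : e <= 2^-1 by rewrite ge_min lexx.
have eb : 2 * b * e <= 1.
  by rewrite -ler_pdivlMl ?mulr_gt0// mulr1 ge_min lexx orbT.
have er0 : 0 < e * r by rewrite mulr_gt0.
have near_z t : eball z (e * r) t ->
    inner D D * inner (t - z) (t - z) <= e ^+ 2.
  rewrite /eball /= => tz; rewrite -!sqr_enorm eD -exprMn.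
  rewrite lerXn2r ?nnegrE ?mulr_ge0 ?invr_ge0 ?enorm_ge0 ?(ltW d0) ?(ltW e0)//.
  by rewrite ler_pdivrMl// mulrC ltW.
have phiz : phi z = u z.
  by rewrite /phi /test_fun /exponent subrr -(scale0r 0) !innerE; rewrite
    !mul0r expr0n mulr0 addr0 subr0 mulr0 expR0 mulr1 subrK.
have umax : local_max (u \- phi) z.
  have := nbhs_eball z er0; apply: filterS => t /near_z tz /=.
  rewrite phiz subrr subr_le0 /phi /test_fun.
  have e4 : e ^+ 2 <= 2^-1 ^+ 2.
    by rewrite lerXn2r ?nnegrE ?invr_ge0 ?(ltW e0).
  have : enorm (t - y) `^ b <= r `^ b * expR (exponent b D z t).
    by apply: powR_enorm_le_test_fun => //; exact: le_trans e4.
  move=> /(ler_wpM2l (ltW c0)); rewrite [leRHS]mulrA.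
  have zt : u t - c * enorm (t - y) `^ b <= u z - A := zmax t.
  by rewrite -lerBlDl; apply: le_trans; rewrite lerBlDr addrC -lerBlDr.
have gphi t : grad phi t != 0 by exact: grad_test_fun_neq0.
have := subsolution_bound u_sub (@C2_test_fun _ _ _ _ _ _ _ _) umax phiz
  gphi er0.
move=> /(_ _ (fun t tz => equation_op_test_fun_le _ A0 b0 D0 p gamma e2 eb
  (near_z t tz) e0)).
apply/negP; rewrite -ltNge eD.
apply: (@lt_le_trans _ _ (lambda0 * A `^ m)).
  rewrite [ltLHS](_ : _ = barrier_const * c `^ (gamma + 1 - m) * A `^ m).
    by rewrite ltr_pM2r// powR_gt0.
  rewrite -[RHS]mulrA -/r.
  transitivity ((A * b * r^-1) `^ gamma * (A * r^-1 ^+ 2) *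
    ((2 * expR 1) `^ `|gamma|
     * (expR 1 * (1 + `|p - 2|) * (4 * b ^+ 2 + 2 * b * n.+1%:R)))).
    by ring.
  by rewrite (scaling_identity b0 c0 d0 hb) /barrier_const -/A; ring.
(* The power m >= 0 is monotone, and u z > A follows from [uz] and u y >= 0. *)
rewrite /absorption; apply: ler_pM; rewrite ?powR_ge0 ?(ltW lambda0_gt0)//.
apply: ge0_ler_powR; rewrite ?nnegrE ?(ltW A0)// le_max ?u0 ?orbT//.
by rewrite ltW//; have := u0 y; rewrite -subr_gt0; move: uz; rewrite -/A; lra.
Qed.

End Growth.

(** * Vanishing of u, by letting c tend to 0 *)

Theorem theorem1p13 (R : realType) (n : nat)
    (p gamma m beta lambda0 Lambda0 : R)
    (a u : 'rV[R]_n.+1 -> R) (x0 : 'rV[R]_n.+1)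
    (hp : 1 < p) (hgamma : -1 < gamma) (hm : 0 <= m < gamma + 1)
    (hbeta : beta = (gamma + 2) / (gamma + 1 - m))
    (ha : continuous a) (hlambda0 : 0 < lambda0)
    (hbounds : forall x, lambda0 <= a x <= Lambda0)
    (hu0 : forall x, 0 <= u x)
    (hu : viscosity_solution p gamma setT (absorption a m) u)
    (hx0 : u x0 = 0)
    (hgrowth : u =o_ enorm_infty (fun x => enorm x `^ beta)) :
  forall x, u x = 0.
Proof.
case/andP: hm => m0 mg; pose s := gamma + 1 - m.
have s0 : 0 < s by rewrite /s; lra.
have b0 : 0 < beta by rewrite hbeta divr_gt0//; lra.
have hb : beta * (gamma + 1 - m) = gamma + 2.
  by rewrite hbeta mulfVK// gt_eqF.
have al x : lambda0 <= a x by case/andP: (hbounds x).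
have [uwithin usub _] := hu.
have cu : continuous u.
  by move=> x; have := uwithin x; rewrite /continuous_at nbhs_subspaceT.
have K0 := barrier_const_gt0 n p gamma b0.
move=> x; apply/eqP; rewrite eq_le hu0 andbT.
(* Chosen so that the barrier constant times c1^s equals lambda0 / 2. *)
pose c1 := (lambda0 / (2 * barrier_const n p gamma beta)) `^ s^-1.
pose E := enorm (x - x0) `^ beta.
have q0 : 0 < lambda0 / (2 * barrier_const n p gamma beta).
  by rewrite divr_gt0// mulr_gt0.
have c10 : 0 < c1 by rewrite powR_gt0.
apply/ler_addgt0Pr => e e0; rewrite add0r.
have E0 : 0 <= E by exact: powR_ge0.
(* The second term gives c E <= e; the denominator 1 + E stays positive when x = x0. *)
pose c := Num.min c1 (e / (1 + E)).
have E1 : 0 < 1 + E by lra.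
have c0 : 0 < c by rewrite lt_min c10 divr_gt0.
have cK : barrier_const n p gamma beta * c `^ (gamma + 1 - m) < lambda0.
  apply: (@le_lt_trans _ _ (barrier_const n p gamma beta * c1 `^ s)).
    rewrite ler_wpM2l ?(ltW K0)//.
    apply: ge0_ler_powR; rewrite ?nnegrE ?(ltW s0) ?(ltW c0) ?(ltW c10)//.
    by rewrite /c ge_min lexx.
  rewrite /c1 -powRrM mulVf ?gt_eqF// powRr1 ?(ltW q0)//.
  rewrite (_ : _ * _ = lambda0 / 2); first by lra.
  by field; rewrite gt_eqF.
have := subsolution_le_barrier b0 hb m0 cu hu0 hlambda0 al usub hgrowth c0 cK
  x x0.
rewrite hx0 add0r => /le_trans; apply; rewrite -/E.
apply: (@le_trans _ _ (e / (1 + E) * (1 + E))); last by rewrite divfK// gt_eqF.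
by apply: ler_pM; rewrite ?(ltW c0)//; [rewrite ge_min lexx orbT|lra].
Qed.
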